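(* Let $\eta>0$, $\lambda>0$, $\varepsilon\ge0$, let $\ell:\mathbb{R}\to\mathbb{R}$ be a differentiable $1$-Lipschitz loss function (e.g. the logistic loss), and let $u\in\mathbb{R}^m$ with $\|u\|\le1$ be fixed. Let $W_t\in\mathbb{R}^{m\times d}$ be the hidden weight matrix of the shallow ReLU network $f_\theta(x)=\langle u,(Wx)_+\rangle$ obtained by running gradient descent (step size $\eta$, $L2$ regularization $\lambda$, initialization $W_0$) for $t$ steps on the training data $(x_i,y_i)_{i=1}^n$, where $x_i\in\mathbb{R}^d$, $\|x_i\|\le1$, $y_i\in\{-1,1\}$. (i) If $x'\in\mathbb{R}^d$ satisfies $\max_i|\langle x_i,x'\rangle|\le\varepsilon$, then for any $t\in\mathbb{N}$, $$\|W_tx'\|\le\|W_0x'\|(1-\eta\lambda)^t+\varepsilon\,\frac{1-(1-\eta\lambda)^t}{\lambda}.$$ (ii) Consequently, let $W'_t$ be obtained in the same way (with the same $u,\eta,\lambda,\ell$) from initialization $W_0'$ on a second training set $(x_i',y_i')_{i=1}^n$ with $\|x_i'\|\le 1$, $y_i'\in\{-1,1\}$, and let $x\in\mathbb{R}^d$ satisfy $\max_i|\langle x_i',x\rangle|\le\varepsilon$. Then for any $t\in\mathbb{N}$, $$|f_{\theta_t+\theta_t'}(x)-f_{\theta_t}(x)|\le\|W_0'x\|(1-\eta\lambda)^t+\varepsilon\,\frac{1-(1-\eta\lambda)^t}{\lambda}.$$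
   Context: $(\cdot)_+=\max(\cdot,0)$ is applied entrywise. Only $W$ is trained; $u$ is fixed and shared by both networks, so $\theta_t=\mathrm{vec}(W_t)$, $\theta'_t=\mathrm{vec}(W'_t)$, and $f_{\theta_t+\theta'_t}(x)=\langle u,((W_t+W_t')x)_+\rangle$. Gradient descent on $\frac1n\sum_i\ell(y_if_\theta(x_i))+\frac\lambda2\|W\|_F^2$ is the iteration $$W_{s+1}=(1-\eta\lambda)W_s-\frac\eta n\sum_{i=1}^n y_i\,\ell'(y_if_{\theta_s}(x_i))\,D_{s,i}\,u\,x_i^\top,\qquad D_{s,i}=\mathrm{diag}(\mathbf 1(W_sx_i>0)),$$ for $s=0,1,2,\dots$, where the indicator is taken entrywise.
   Formalization: The formal statement adds the step-size condition ηλ ≤ 1; for ηλ > 1 the claim fails, e.g. m=d=n=1, u=0, x_1=0, W_0=1, x'=1, ε=0, t=1, where |1−ηλ| > 0 > 1−ηλ. *)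

(* Defs.v *)
From HB Require Import structures.
From mathcomp Require Import all_boot all_order all_algebra.
From mathcomp Require Import all_classical all_reals all_analysis.
Import Order.TTheory GRing.Theory Num.Theory.
Import numFieldNormedType.Exports.

Set Implicit Arguments.
Unset Strict Implicit.
Unset Printing Implicit Defensive.

Local Open Scope ring_scope.

Definition dot {R : realType} {k : nat} (v w : 'cV[R]_k) : R :=
  \sum_(i < k) v i 0 * w i 0.

(* The norm `|v| that MathComp-Analysis puts on matrices is the sup norm, so
   the Euclidean norm needs its own definition. *)
Definition enorm {R : realType} {k : nat} (v : 'cV[R]_k) : R :=
  Num.sqrt (dot v v).

Definition relu {R : realType} {k : nat} (v : 'cV[R]_k) : 'cV[R]_k :=
  map_mx (fun a => Num.max a 0) v.

Definition shallow_relu {R : realType} {m d : nat}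
    (u : 'cV[R]_m) (W : 'M[R]_(m, d)) (x : 'cV[R]_d) : R :=
  dot u (relu (W *m x)).

(* diag(1(W x > 0)); the derivative of the ReLU at 0 is taken to be 0. *)
Definition activation {R : realType} {m d : nat}
    (W : 'M[R]_(m, d)) (x : 'cV[R]_d) : 'M[R]_m :=
  diag_mx (\row_k (0 < (W *m x) k 0)%R%:R).

(* One step on (1/n) \sum_i ell (y_i f_W(x_i)) + (lambda/2) ||W||_F^2, with the
   ridge term absorbed in the factor 1 - eta * lambda. *)
Definition gd_step {R : realType} {m d n : nat} (eta lambda : R) (ell : R -> R)
    (u : 'cV[R]_m) (x : 'I_n -> 'cV[R]_d) (y : 'I_n -> R)
    (W : 'M[R]_(m, d)) : 'M[R]_(m, d) :=
  (1 - eta * lambda) *: W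
  - (eta / n%:R) *: \sum_(i < n)
      (y i * (ell^`())%classic (y i * shallow_relu u W (x i)))
        *: (activation W (x i) *m u *m (x i)^T).

Definition gd {R : realType} {m d n : nat} (eta lambda : R) (ell : R -> R)
    (u : 'cV[R]_m) (x : 'I_n -> 'cV[R]_d) (y : 'I_n -> R)
    (W0 : 'M[R]_(m, d)) (t : nat) : 'M[R]_(m, d) :=
  iter t (gd_step eta lambda ell u x y) W0.

(* Main.v *)
(* Unrolling one step on a vector z, each sample contributes a multiple of D u
   with coefficient at most |<x_i, z>| <= eps in absolute value, because
   |y_i l'| <= 1 and |D u| <= |u| <= 1.  Hence a_t = |W_t z| satisfies
   a_{t+1} <= (1 - eta lambda) a_t + eta eps, a geometric recursion.  Part (ii)
   follows by Cauchy-Schwarz since the ReLU is 1-Lipschitz. *)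
Require Import Defs.
From HB Require Import structures.
From mathcomp Require Import all_boot all_order all_algebra.
From mathcomp Require Import all_classical all_reals all_analysis.
From mathcomp Require Import ring lra.
Import Order.TTheory GRing.Theory Num.Theory.
Import numFieldNormedType.Exports.

Local Open Scope ring_scope.

Lemma dotC (R : realType) k (v w : 'cV[R]_k) : dot v w = dot w v.
Proof. by apply: eq_bigr => i _; rewrite mulrC. Qed.

Lemma dotDr (R : realType) k (u v w : 'cV[R]_k) :
  dot u (v + w) = dot u v + dot u w.
Proof. by rewrite /dot -big_split; apply: eq_bigr => i _; rewrite mxE mulrDr. Qed.

Lemma dotZr (R : realType) k (a : R) (v w : 'cV[R]_k) :
  dot v (a *: w) = a * dot v w.
Proof. by rewrite /dot mulr_sumr; apply: eq_bigr => i _; rewrite mxE mulrCA. Qed.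

Lemma dotBr (R : realType) k (u v w : 'cV[R]_k) :
  dot u (v - w) = dot u v - dot u w.
Proof. by rewrite -scaleN1r dotDr dotZr mulN1r. Qed.

Lemma dot_ge0 (R : realType) k (v : 'cV[R]_k) : 0 <= dot v v.
Proof. by apply: sumr_ge0 => i _; rewrite -expr2 sqr_ge0. Qed.

Lemma dot_eq0 (R : realType) k (v : 'cV[R]_k) : dot v v = 0 -> v = 0.
Proof.
move=> /eqP; rewrite psumr_eq0; last by move=> i _; rewrite -expr2 sqr_ge0.
move=> /allP v0; apply/colP => i; rewrite mxE; apply/eqP.
by have := v0 i (mem_index_enum _); rewrite mulf_eq0 orbb.
Qed.

Lemma dot_sqr_le (R : realType) k (v w : 'cV[R]_k) :
  dot v w ^+ 2 <= dot v v * dot w w.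
Proof.
have [/dot_eq0 ->|w_neq0] := eqVneq (dot w w) 0.
  by rewrite -(scale0r 0) !dotZr !mul0r expr0n mulr0.
have w_gt0 : 0 < dot w w by rewrite lt_def w_neq0 dot_ge0.
(* This vector is [dot w w] times the component of [v] orthogonal to [w]. Its squared length equals
   [dot w w] times the gap in the claim, so dividing by the positive [dot w w] suffices. *)
have := dot_ge0 _ _ (dot w w *: v - dot v w *: w).
rewrite dotBr !dotZr ![dot (_ - _) _]dotC !dotBr !dotZr (dotC _ _ w v).
set p := dot w w in w_gt0 *; set q := dot v w; set r := dot v v => h.
rewrite -subr_ge0 -(pmulr_rge0 _ w_gt0); apply: le_trans h _.
by rewrite le_eqVlt; apply/orP; left; apply/eqP; ring.
Qed.

Lemma enorm_ge0 (R : realType) k (v : 'cV[R]_k) : 0 <= enorm v.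
Proof. exact: sqrtr_ge0. Qed.

Lemma enorm_sqr (R : realType) k (v : 'cV[R]_k) : enorm v ^+ 2 = dot v v.
Proof. by rewrite sqr_sqrtr // dot_ge0. Qed.

Lemma cauchy_schwarz (R : realType) k (v w : 'cV[R]_k) :
  `|dot v w| <= enorm v * enorm w.
Proof. by rewrite /enorm -sqrtrM ?dot_ge0// -sqrtr_sqr ler_wsqrtr ?dot_sqr_le. Qed.

Lemma enorm_triangle (R : realType) k (v w : 'cV[R]_k) :
  enorm (v + w) <= enorm v + enorm w.
Proof.
rewrite -ler_sqr ?nnegrE ?addr_ge0 ?enorm_ge0// sqrrD !enorm_sqr.
rewrite dotDr ![dot (_ + _) _]dotC !dotDr (dotC _ _ w v).
have := le_trans (ler_norm _) (cauchy_schwarz _ _ v w).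
rewrite mulr2n; lra.
Qed.

Lemma enormZ (R : realType) k (a : R) (v : 'cV[R]_k) :
  enorm (a *: v) = `|a| * enorm v.
Proof.
by rewrite /enorm dotZr dotC dotZr mulrA -expr2 sqrtrM ?sqr_ge0// sqrtr_sqr.
Qed.

Lemma enorm_sum (R : realType) k n (F : 'I_n -> 'cV[R]_k) :
  enorm (\sum_i F i) <= \sum_i enorm (F i).
Proof.
elim/big_ind2: _ => // [|a v b w av bw].
  by rewrite -(scale0r 0) enormZ normr0 mul0r.
exact: le_trans (enorm_triangle _ _ _ _) (lerD av bw).
Qed.

(** Reduces the two ReLU bounds below, for the 0/1 mask and for the Lipschitz property, to scalar
    inequalities. *)
Lemma le_enorm (R : realType) k (v w : 'cV[R]_k) :
  (forall i, `|v i 0| <= `|w i 0|) -> enorm v <= enorm w.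
Proof.
move=> vw; apply/ler_wsqrtr/ler_sum => i _.
by rewrite -!expr2 -(real_normK (num_real (v i 0))) -(real_normK (num_real (w i 0)))
  ler_sqr ?nnegrE.
Qed.

Lemma enorm_activation (R : realType) m d (W : 'M[R]_(m, d)) x (u : 'cV[R]_m) :
  enorm (activation W x *m u) <= enorm u.
Proof.
apply: le_enorm => i; rewrite mul_diag_mx !mxE.
by case: (0 < _); rewrite ?mul1r ?mul0r ?normr0.
Qed.

Lemma enorm_reluB (R : realType) k (v w : 'cV[R]_k) :
  enorm (relu v - relu w) <= enorm (v - w).
Proof.
apply: le_enorm => i; rewrite !mxE.
set a := v i 0; set b := w i 0.
(* In each of the four sign cases the claim is linear once [|a - b|] is known to dominate both
   [a - b] and [b - a]. *)
case: (leP a 0) => ha; case: (leP b 0) => hb; rewrite ler_norml;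
  have := ler_norm (a - b); have := ler_norm (b - a); rewrite (distrC b a);
  move=> h1 h2; have := normr_ge0 (a - b); lra.
Qed.

(** Every difference quotient lies in the closed interval [-1, 1], hence so does its limit. *)
Lemma lipschitz_derive1_le1 (R : realType) (f : R -> R) (a : R) :
  derivable f a 1 -> (forall b c, `|f b - f c| <= `|b - c|) ->
  `|(f^`())%classic a| <= 1.
Proof.
move=> df lf.
have bnd h : h != 0 -> `|h^-1 *: (f (h *: 1 + a) - f a)| <= 1.
  move=> h0; rewrite normrM normfV mulrC ler_pdivrMr ?normr_gt0// mul1r.
  by apply: le_trans (lf _ _) _; rewrite addrK /GRing.scale/= mulr1.
rewrite derive1E ler_norml; apply/andP; split.
  apply: limr_ge; first exact: df.
  near=> h; have := bnd h; rewrite ler_norml => /(_ _)/andP[]//.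
  by near: h; exact: nbhs_dnbhs_neq.
apply: limr_le; first exact: df.
near=> h; have := bnd h; rewrite ler_norml => /(_ _)/andP[]//.
by near: h; exact: nbhs_dnbhs_neq.
Unshelve. all: by end_near. Qed.

(** Each gradient term is a rank-one matrix [D u x_i^T], so applied to [z] it collapses to the
    vector [D u] scaled by the inner product of [x_i] and [z]. This is where near-orthogonality
    enters. *)
Lemma gd_stepMr (R : realType) m d n (eta lambda : R) (ell : R -> R)
    (u : 'cV[R]_m) (x : 'I_n -> 'cV[R]_d)
    (y : 'I_n -> R) (W : 'M[R]_(m, d)) (z : 'cV[R]_d) :
  gd_step eta lambda ell u x y W *m z =
  (1 - eta * lambda) *: (W *m z) -
  (eta / n%:R) *: \sum_(i < n)
    (y i * (ell^`())%classic (y i * shallow_relu u W (x i)) * dot (x i) z)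
      *: (activation W (x i) *m u).
Proof.
rewrite /gd_step mulmxBl -!scalemxAl mulmx_suml; congr (_ - _ *: _).
apply: eq_bigr => i _; rewrite -scalemxAl -[RHS]scalerA; congr (_ *: _).
have xz : (x i)^T *m z = (dot (x i) z)%:M.
  apply/matrixP => a b; rewrite !ord1 !mxE eqxx mulr1n.
  by apply: eq_bigr => j _; rewrite mxE.
by rewrite -[LHS]mulmxA xz mul_mx_scalar.
Qed.

Lemma enorm_gd_step (R : realType) m d n (eta lambda eps : R) (ell : R -> R)
    (u : 'cV[R]_m) (x : 'I_n -> 'cV[R]_d)
    (y : 'I_n -> R) (W : 'M[R]_(m, d)) (z : 'cV[R]_d) :
  (0 < n)%N -> 0 <= eta -> eta * lambda <= 1 ->
  (forall a, derivable ell a 1) ->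
  (forall a b, `|ell a - ell b| <= `|a - b|) ->
  enorm u <= 1 -> (forall i, `|y i| <= 1) ->
  (forall i, `|dot (x i) z| <= eps) ->
  enorm (gd_step eta lambda ell u x y W *m z) <=
  (1 - eta * lambda) * enorm (W *m z) + eta * eps.
Proof.
move=> n_gt0 eta_ge0 el_le1 dell lell u_le1 y_le1 xz.
rewrite gd_stepMr -(scaleNr (eta / _)).
apply: le_trans (enorm_triangle _ _ _ _) _.
(* [eta * lambda <= 1] lets the absolute value around [1 - eta * lambda] be dropped. Beyond that
   range the bound can fail: with [eps = 0] and [W *m z] nonzero its right-hand side is negative. *)
rewrite !enormZ ger0_norm ?subr_ge0// lerD2l normrN.
rewrite ger0_norm ?divr_ge0// -mulrA ler_wpM2l// mulrC ler_pdivrMr ?ltr0n//.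
apply: le_trans (enorm_sum _ _ _ _) _.
(* The averaging factor 1/n has been cleared to the right, so each of the [n] samples may contribute
   [eps]. *)
have -> : eps * n%:R = \sum_(i < n) eps by rewrite sumr_const card_ord mulr_natr.
apply: ler_sum => i _; rewrite enormZ !normrM -[leRHS]mulr1.
apply: ler_pM => //; rewrite ?mulr_ge0 ?enorm_ge0//; last first.
  exact: le_trans (enorm_activation _ _ _ _ _ _) u_le1.
rewrite -[leRHS]mul1r; apply: ler_pM => //; rewrite ?mulr_ge0//.
rewrite -[leRHS]mul1r; apply: ler_pM => //.
exact: lipschitz_derive1_le1.
Qed.

Lemma enorm_gd (R : realType) m d n (eta lambda eps : R) (ell : R -> R)
    (u : 'cV[R]_m) (x : 'I_n -> 'cV[R]_d)
    (y : 'I_n -> R) (W0 : 'M[R]_(m, d)) (z : 'cV[R]_d) t :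
  (0 < n)%N -> 0 <= eta -> 0 < lambda -> eta * lambda <= 1 ->
  (forall a, derivable ell a 1) ->
  (forall a b, `|ell a - ell b| <= `|a - b|) ->
  enorm u <= 1 -> (forall i, `|y i| <= 1) ->
  (forall i, `|dot (x i) z| <= eps) ->
  enorm (gd eta lambda ell u x y W0 t *m z) <=
  enorm (W0 *m z) * (1 - eta * lambda) ^+ t
  + eps * ((1 - (1 - eta * lambda) ^+ t) / lambda).
Proof.
move=> n_gt0 eta_ge0 l_gt0 el_le1 dell lell u_le1 y_le1 xz.
elim: t => [|t IH]; first by rewrite expr0 subrr mul0r mulr0 addr0 mulr1.
rewrite /gd iterS -/(gd _ _ _ _ _ _ _ _).
apply: le_trans (enorm_gd_step _ _ _ _ _ _ eps _ _ _ _ _ _ _ _ _ _ _ _ _ _) _ => //.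
(* Multiplying the induction hypothesis by the contraction factor keeps its direction because that
   factor is nonnegative. *)
have := ler_wpM2l _ IH; rewrite -subr_ge0 in el_le1 => /(_ _ el_le1).
rewrite -(lerD2r (eta * eps)) => /le_trans; apply.
(* The closed form satisfies the recursion with equality: the coefficient of [eps] is the geometric
   sum of [eta * (1 - eta * lambda) ^+ s] over s < t. *)
rewrite exprS le_eqVlt; apply/orP; left; apply/eqP.
by field; rewrite gt_eqF.
Qed.

(** The two pre-activations differ by exactly [W' *m z], so the bound does not depend on [W]. *)
Lemma shallow_relu_addl (R : realType) m d (u : 'cV[R]_m) (W W' : 'M[R]_(m, d)) z :
  enorm u <= 1 ->
  `|shallow_relu u (W + W') z - shallow_relu u W z| <= enorm (W' *m z).
Proof.
move=> u_le1; rewrite /shallow_relu -dotBr.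
apply: le_trans (cauchy_schwarz _ _ _ _) _.
rewrite -[leRHS]mul1r ler_pM ?enorm_ge0//.
by apply: le_trans (enorm_reluB _ _ _ _) _; rewrite mulmxDl addrC addKr.
Qed.

Theorem lemma4 (R : realType) (m d n : nat) (eta lambda eps : R)
    (ell : R -> R) (u : 'cV[R]_m)
    (x : 'I_n -> 'cV[R]_d)
    (y : 'I_n -> R) (W0 : 'M[R]_(m, d))
    (n_gt0 : (0 < n)%N)
    (eta_gt0 : 0 < eta) (lambda_gt0 : 0 < lambda) (eps_ge0 : 0 <= eps)
    (eta_lambda_le1 : eta * lambda <= 1)
    (ell_derivable : forall a : R, derivable ell a 1)
    (ell_lipschitz : forall a b : R, `|ell a - ell b| <= `|a - b|)
    (u_le1 : enorm u <= 1)
    (x_le1 : forall i : 'I_n, enorm (x i) <= 1)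
    (y_pm1 : forall i : 'I_n, y i = -1 \/ y i = 1) :
  (forall x' : 'cV[R]_d,
     \big[Num.max/0]_(i < n) `|dot (x i) x'| <= eps ->
     forall t : nat,
       enorm (gd eta lambda ell u x y W0 t *m x')
         <= enorm (W0 *m x') * (1 - eta * lambda) ^+ t
            + eps * ((1 - (1 - eta * lambda) ^+ t) / lambda))
  /\
  (forall (x' : 'I_n -> 'cV[R]_d) (y' : 'I_n -> R) (W0' : 'M[R]_(m, d)),
     (forall i : 'I_n, enorm (x' i) <= 1) ->
     (forall i : 'I_n, y' i = -1 \/ y' i = 1) ->
     forall z : 'cV[R]_d,
     \big[Num.max/0]_(i < n) `|dot (x' i) z| <= eps ->
     forall t : nat,
       `|shallow_relu u (gd eta lambda ell u x y W0 t
                         + gd eta lambda ell u x' y' W0' t) z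
         - shallow_relu u (gd eta lambda ell u x y W0 t) z|
         <= enorm (W0' *m z) * (1 - eta * lambda) ^+ t
            + eps * ((1 - (1 - eta * lambda) ^+ t) / lambda)).
Proof.
have sign_le1 (b : 'I_n -> R) : (forall i, b i = -1 \/ b i = 1) ->
    forall i, `|b i| <= 1.
  by move=> bP i; case: (bP i) => ->; rewrite ?normrN normr1.
have le_eps (a : 'I_n -> 'cV[R]_d) z :
    \big[Num.max/0]_(i < n) `|dot (a i) z| <= eps ->
    forall i, `|dot (a i) z| <= eps.
  by move=> h i; apply: le_trans h; exact: le_bigmax.
split=> [z /le_eps xz t|x' y' W0' _ /sign_le1 y'_le1 z /le_eps xz t].
  by apply: enorm_gd => //; [exact: ltW | exact: sign_le1].
(* What remains is the estimate of part (i) for the second network, since [z] is nearly orthogonal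
   to the second training set. *)
apply: le_trans (shallow_relu_addl _ _ _ _ _ _ _ u_le1) _.
by apply: enorm_gd => //; exact: ltW.
Qed.
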